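(* The Quotient Model (defined in the context) with function $c$ is Pareto-conform if $c(d)\le 1$ and $c(x)\,(1-c(x))-x\,c'(x)\le 0$ for all $x\in[0,d]$.
   Context: Let $G=(V,E)$ be a directed graph, $s,t\in V$, $d>0$ rational. Every edge $e$ has a cost function $\tau_e:\mathbb{Q}_{\ge 0}\to\mathbb{Q}_{>0}$, monotonically increasing and differentiable; functions are considered on $[0,d]$ and inequalities between functions are pointwise on $[0,d]$. Paths are identified with edge sets; $\tau_A=\sum_{e\in A}\tau_e$ (zero if $A=\emptyset$), $\tau'_A$ its derivative. An original simple $s$–$t$ path $Q$ is fixed; an alternative is a simple $s$–$t$ path $P$, and $\mathcal{C}_P(x)=x\,\tau_{P\setminus Q}(x)+(d-x)\,\tau_{Q\setminus P}(d-x)+d\,\tau_{P\cap Q}(d)$; a psychological model assigns $x_P\in[0,d]$ to each alternative and $\mathcal{C}_P:=\mathcal{C}_P(x_P)$. Dominance: $P_1\preceq P_2$ iff $\tau_{P_1}\le\tau_{P_2}$ and $\tau'_{P_1\cap Q}\le\tau'_{P_2\cap Q}$. A model is Pareto-conform if $P_1\preceq P_2$ implies $\mathcal{C}_{P_1}\le\mathcal{C}_{P_2}$. Quotient Model: let $c:[0,d]\to\mathbb{R}$ be differentiable, non-decreasing and non-negative with $c(d)>0$. If $\dfrac{\tau_{Q\setminus P}(d-x)+\tau_{P\cap Q}(d)}{\tau_{P\setminus Q}(x)+\tau_{P\cap Q}(d)}=c(x)$ has a solution in $[0,d]$ (then unique), $x_P$ is that solution; otherwise $x_P=0$ if the left-hand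 side is smaller than $c(x)$ for all $x\in[0,d]$, and $x_P=d$ if it is larger than $c(x)$ for all $x\in[0,d]$.
   Formalization: The cost functions, given in the text only on the nonnegative rationals, are assumed to extend to monotone, positive, differentiable functions on the nonnegative reals; [0,d], the solutions x_P and the dominance inequalities are read over the reals. *)

(* Defs.v *)
(* MathComp / MathComp-Analysis. *)
From HB Require Import structures.
From mathcomp Require Import all_boot all_order all_algebra.
From mathcomp Require Import all_classical all_reals all_analysis.

Set Implicit Arguments.
Unset Strict Implicit.
Unset Printing Implicit Defensive.

Import Order.TTheory GRing.Theory Num.Theory.
Import numFieldNormedType.Exports.

Local Open Scope classical_set_scope.
Local Open Scope ring_scope.

Section RelativeDerivative.
Context {R : realType}.

(* The library's [derivable] and [derive1] are two-sided.  Here the difference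
   quotient is restricted to a set [D], so that at an endpoint of an interval
   the derivative is the one-sided one. *)
Definition derivable_on (D : set R) (f : R -> R) : Prop :=
  forall x, D x -> cvg ((f y - f x) / (y - x) @[y --> within D x^']).

Definition derive_on (D : set R) (f : R -> R) (x : R) : R :=
  lim ((f y - f x) / (y - x) @[y --> within D x^']).

(* A differentiable, monotone cost function from the nonnegative rationals to
   the positive rationals, given by its extension to the nonnegative reals;
   the values at negative arguments are irrelevant. *)
Definition cost_function (f : R -> R) : Prop :=
  [/\ forall q : R, rational q -> 0 <= q -> rational (f q),
      forall y, 0 <= y -> 0 < f y,
      {in `[0, +oo[ &, {homo f : y z / y <= z}}
    & derivable_on `[0, +oo[ f].

End RelativeDerivative.

Section Paths.
Context {V E : finType}.
(* Edges form a type of their own, so parallel edges are allowed; a digraph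
   with edge set A, a subset of V * V, is the case where E is the subtype of
   the pairs in A and src, tgt are the two projections. *)
Variables (src tgt : E -> V).

Fixpoint walk (u : V) (p : seq E) (v : V) : bool :=
  if p is e :: p' then (src e == u) && walk (tgt e) p' v else u == v.

Definition simple_path (u v : V) (P : {set E}) : Prop :=
  exists p : seq E,
    [/\ walk u p v, uniq (u :: [seq tgt e | e <- p]) & P = [set e in p]%SET].

End Paths.

Section Routing.
Context {R : realType} {E : finType}.
Variables (d : R) (tau : E -> R -> R) (Q : {set E}).

Definition path_cost (A : {set E}) (y : R) : R := \sum_(e in A) tau e y.

Definition overall_cost (P : {set E}) (y : R) : R :=
  y * path_cost (P :\: Q) y + (d - y) * path_cost (Q :\: P) (d - y)
  + d * path_cost (P :&: Q) d.

Definition dominates (P1 P2 : {set E}) : Prop :=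
  forall y, y \in `[0, d] ->
    path_cost P1 y <= path_cost P2 y /\
    derive_on `[0, +oo[ (path_cost (P1 :&: Q)) y
      <= derive_on `[0, +oo[ (path_cost (P2 :&: Q)) y.

Definition pareto_conform (alternative : {set E} -> Prop)
    (x : {set E} -> R) : Prop :=
  forall P1 P2, alternative P1 -> alternative P2 -> dominates P1 P2 ->
    overall_cost P1 (x P1) <= overall_cost P2 (x P2).

Definition cost_quotient (P : {set E}) (y : R) : R :=
  (path_cost (Q :\: P) (d - y) + path_cost (P :&: Q) d)
  / (path_cost (P :\: Q) y + path_cost (P :&: Q) d).

(* Uniqueness of the solution is not assumed (it can fail, for instance for
   P = Q and c = 1): x P may be any solution. *)
Definition quotient_model (c : R -> R) (alternative : {set E} -> Prop)
    (x : {set E} -> R) : Prop :=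
  forall P, alternative P ->
    [/\ x P \in `[0, d],
        (exists2 y, y \in `[0, d] & cost_quotient P y = c y) ->
          cost_quotient P (x P) = c (x P),
        (forall y, y \in `[0, d] -> cost_quotient P y < c y) -> x P = 0
      & (forall y, y \in `[0, d] -> c y < cost_quotient P y) -> x P = d].

End Routing.

(* Main.v *)
(* Put A_P(y) = tau_{P\Q}(y) + tau_{P&Q}(d) and
   B_P(y) = tau_{Q\P}(d - y) + tau_{P&Q}(d), so that the overall cost of P is
   y A_P(y) + (d - y) B_P(y) and the model equalizes B_P and c A_P.  Since
   A_P(y) = tau_P(y) + (tau_{P&Q}(d) - tau_{P&Q}(y)), and likewise for B_P with
   tau_Q(d - y) in place of tau_P(y), dominance of P1 over P2 gives
   A_{P1} <= A_{P2} and B_{P1} <= B_{P2} by the mean value theorem.  If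
   x_{P1} <= x_{P2}, the two costs are compared through A, otherwise through
   B. *)
Require Import Defs.
From HB Require Import structures.
From mathcomp Require Import all_boot all_order all_algebra.
From mathcomp Require Import all_classical all_reals all_analysis.
From mathcomp Require Import ring lra.

Set Implicit Arguments.
Unset Strict Implicit.
Unset Printing Implicit Defensive.

Import Order.TTheory GRing.Theory Num.Theory.
Import numFieldNormedType.Exports.

Local Open Scope classical_set_scope.
Local Open Scope ring_scope.

(** * Derivatives and continuity relative to a set *)

(** Near an interior point the restriction to [D] is void, so both punctured filters coincide. This
    opens the way to the two-sided mean value theorem. *)
Lemma derivable_on_is_derive (R : realType) (D : set R) (f : R -> R) (y : R) :
  derivable_on D f -> D° y -> is_derive y 1 f (derive_on D f y).
Proof.
move=> df Dy; have wD : within D y^' = y^'.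
  rewrite eqEsubset; split => A; rewrite /within /dnbhs /within /=; last first.
    by apply: filterS => z zA /zA.
  have : \forall z \near y, D z by exact: Dy.
  by apply: filterS2 => z Dz zA /zA; apply.
have := df _ (interior_subset Dy); rewrite /derive_on wD.
set l := lim _ => cl.
suff cl' : (fun h : R => h^-1 *: ((f \o shift y) (h *: 1) - f y)) @ 0^' --> l.
  by apply: DeriveDef; [apply/cvg_ex; exists l|exact: cvg_lim].
(* [is_derive] takes the limit in the increment, [derive_on] in the point. Translation by [y] is
   continuous and injective, so it carries [0^'] to [y^']. *)
have shift_y : shift y @ (0 : R)^' --> y^'.
  rewrite -[X in _ --> X^'](add0r y).
  apply: (@continuous_injective_withinNx R R (shift y)) => [|z].
    by apply: cvgD; [exact: cvg_id|exact: cvg_cst].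
  by move/addIr.
have := cvg_comp _ _ shift_y cl; apply: cvg_trans.
apply: near_eq_cvg; apply: nearW => h /=.
by rewrite addrK [h *: 1]mulr1 [_ *: _]mulrC.
Qed.

Lemma derivable_on_continuous (R : realType) (D : set R) (f : R -> R) :
  derivable_on D f -> {within D, continuous f}.
Proof.
move=> df; apply/subspace_continuousP.
suff cf (y : R) : D y -> f z @[z --> within D (nbhs y)] --> f y by exact: cf.
move=> Dy; have /cvg_ex [l cl] := df _ Dy.
suff : f z @[z --> within D y^'] --> f y.
  move=> fy A fA.
  have : \forall z \near y, z != y -> D z -> A (f z) := fy A fA.
  suff fA' : (\forall z \near y, z != y -> D z -> A (f z)) ->
      \forall z \near y, D z -> A (f z) by exact: fA'.
  apply: filterS => z zA Dz; have [->|zy] := eqVneq z y; last exact: zA.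
  exact: nbhs_singleton.
have idy : z - y @[z --> within D y^'] --> (0 : R).
  rewrite -(subrr y); apply: cvgB; last exact: cvg_cst.
  have : z @[z --> y^'] --> y by exact: nbhs_dnbhs.
  exact: cvg_within_filter.
have FD : Filter (within D y^') by exact: within_filter.
(* Off [y], [f z] is the difference quotient times [z - y] plus [f y], which tends to
   [l * 0 + f y]. *)
have h : (f z - f y) / (z - y) * (z - y) + f y @[z --> within D y^'] --> f y.
  rewrite -[X in _ --> X]add0r -(mulr0 l).
  by apply: cvgD; [exact: cvgM|exact: cvg_cst].
refine (cvg_trans _ h).
apply: near_eq_cvg.
suff fE : \forall z \near y, z != y -> D z ->
    (f z - f y) / (z - y) * (z - y) + f y = f z by exact: fE.
by apply: filterE => z zy _ /=; rewrite divfK ?subr_eq0// subrK.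
Qed.

Lemma derivable_on_sum (R : realType) (I : Type) (r : seq I) (P : pred I)
    (D : set R) (f : I -> R -> R) :
  (forall i, derivable_on D (f i)) ->
  derivable_on D (fun y => \sum_(i <- r | P i) f i y).
Proof.
move=> df y Dy; elim: r => [|i r IHr].
  by under eq_fun do rewrite !big_nil subrr mul0r; exact: is_cvg_cst.
under eq_fun do rewrite !big_cons.
case: (P i); last exact: IHr.
under eq_fun do rewrite opprD addrACA mulrDl.
by apply: is_cvgD; [exact: df|exact: IHr].
Qed.

Lemma within_continuous_reflect (R : realType) (d : R) (f : R -> R) :
  {within `[0, d], continuous f} ->
  {within `[0, d], continuous (fun y => f (d - y))}.
Proof.
move=> /subspace_continuousP cf; apply/subspace_continuousP.
suff cfB (y : R) : `[0, d]%classic y ->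
    f (d - z) @[z --> within `[0, d] (nbhs y)] --> f (d - y) by exact: cfB.
move=> yd; have dyd : `[0, d]%classic (d - y).
  by move: yd; rewrite /= !in_itv /=; lra.
apply: cvg_comp (cf _ dyd) => A dA.
have cB : (d - z) @[z --> y] --> d - y.
  by apply: cvgB; [exact: cvg_cst|exact: cvg_id].
suff dAB : (\forall z \near y, `[0, d]%classic (d - z) -> A (d - z)) ->
    \forall z \near y, `[0, d]%classic z -> A (d - z) by exact: dAB (cB _ dA).
apply: filterS => z zA zd; apply: zA.
by move: zd; rewrite /= !in_itv /=; lra.
Qed.

(* [y / c y - y] is nonincreasing because the numerator of its derivative is
   [c y (1 - c y) - y c'(y)]. *)
Lemma div_subr_nonincreasing (R : realType) (d : R) (c : R -> R) (u v : R) :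
  derivable_on `[0, d] c ->
  {in `[0, d] &, {homo c : y z / y <= z}} ->
  (forall y, y \in `[0, d] ->
     c y * (1 - c y) - y * derive_on `[0, d] c y <= 0) ->
  0 <= u -> u <= v -> v <= d -> 0 < c u ->
  v / c v - v <= u / c u - u.
Proof.
move=> dc c_homo c_ineq u0 uv vd cu.
(* [c] may vanish at small arguments; monotonicity carries positivity from [u] to everything on its
   right. *)
have cgt0 y : u <= y -> y <= d -> 0 < c y.
  move=> uy yd; apply: lt_le_trans cu (c_homo _ _ _ _ _);
    by rewrite ?in_itv/=; lra.
move: uv; rewrite le_eqVlt => /predU1P[->//|uv].
pose dphi y := (c y * (1 - c y) - y * derive_on `[0, d] c y) / (c y ^+ 2).
have [y yuv dphiE] : exists2 y, y \in `]u, v[ &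
    (v / c v - v) - (u / c u - u) = dphi y * (v - u).
  apply: (@MVT R (fun y => y / c y - y)) => // [y|].
    rewrite in_itv /= => /andP[uy yv].
    have cy : 0 < c y by apply: cgt0; lra.
    have dcy : is_derive y 1 c (derive_on `[0, d] c y).
      apply: derivable_on_is_derive => //.
      by rewrite interior_itv /= in_itv /=; lra.
    have dcV : is_derive y 1 (fun z => (c z)^-1)
        (- (c y) ^- 2 *: derive_on `[0, d] c y).
      apply: DeriveDef; first by apply: derivableV; rewrite ?gt_eqF.
      by rewrite deriveV ?gt_eqF// derive_val.
    apply: is_derive_eq.
    transitivity (y * (- (c y) ^- 2 * derive_on `[0, d] c y)
      + (c y)^-1 * 1 - 1) => //; rewrite /dphi.
    field; exact: lt0r_neq0.
  have cc : {within `[u, v], continuous c}.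
    apply: continuous_subspaceW (derivable_on_continuous dc).
    by apply: subset_itv; rewrite bnd_simp.
  apply/subspace_continuousP => y yuv; apply: cvgB; last exact: cvg_within.
  apply: cvgM; first exact: cvg_within.
  apply: cvgV; last by move/subspace_continuousP: cc; exact.
  move: yuv; rewrite /= in_itv /= => /andP[uy yv].
  by rewrite gt_eqF// cgt0//; lra.
rewrite -subr_le0 dphiE; apply: mulr_le0_ge0; last by lra.
move: yuv; rewrite in_itv /= => /andP[uy yv].
apply: mulr_le0_ge0; last by rewrite invr_ge0 sqr_ge0.
by apply: c_ineq; rewrite in_itv /=; lra.
Qed.

(** * Equalization in the model and comparison of two equalized costs *)

(** A solution gives [B x = c x * A x]. Without one, the continuous function [c A - B] has no zero,
    hence a constant sign, and a default clause puts [x] at the endpoint where one of the two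
    inequalities is vacuous and the other is that sign. *)
Lemma quotient_equalization (R : realType) (d : R) (A B c : R -> R) (x : R) :
  0 < d -> x \in `[0, d] ->
  {within `[0, d], continuous A} -> {within `[0, d], continuous B} ->
  {within `[0, d], continuous c} ->
  (forall y, y \in `[0, d] -> 0 < A y) ->
  ((exists2 y, y \in `[0, d] & B y / A y = c y) -> B x / A x = c x) ->
  ((forall y, y \in `[0, d] -> B y / A y < c y) -> x = 0) ->
  ((forall y, y \in `[0, d] -> c y < B y / A y) -> x = d) ->
  (x < d -> B x <= c x * A x) /\ (0 < x -> c x * A x <= B x).
Proof.
move=> d0 xd cA cB cc A0 xsol xlt xgt.
have [/xsol sol|nosol] := pselect (exists2 y, y \in `[0, d] & B y / A y = c y).
  have -> : c x * A x = B x by rewrite -sol divfK// gt_eqF// A0.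
  by split.
pose f y := c y * A y - B y.
have cf : {within `[0, d], continuous f}.
  move=> y; apply: cvgB; last exact: cB.
  by apply: cvgM; [exact: cc|exact: cA].
have fneq0 y : y \in `[0, d] -> f y != 0.
  move=> yd; apply/negP => /eqP /subr0_eq cAB; apply: nosol; exists y => //.
  by rewrite -cAB mulfK// gt_eqF// A0.
have in0d z : 0 <= z -> z <= d -> z \in `[0, d].
  by move=> *; rewrite in_itv /=; apply/andP.
(* Intermediate value theorem: a sign change between [y] and [z], in either direction, would produce
   a zero of [f]. *)
have sgf y z : 0 <= y -> y <= z -> z <= d ->
    ~ (Num.min (f y) (f z) <= 0 <= Num.max (f y) (f z)).
  move=> y0 yz zd fyz.
  have [|w wyz fw] := @IVT R f y z 0 yz _ fyz.
    by apply: continuous_subspaceW cf; apply: subset_itv; rewrite bnd_simp.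
  move: wyz; rewrite in_itv /= => /andP[yw wz].
  have /fneq0 : w \in `[0, d] by apply: in0d; lra.
  by rewrite fw eqxx.
have same y z : y \in `[0, d] -> z \in `[0, d] -> 0 < f y -> 0 < f z.
  rewrite !in_itv /= => /andP[y0 yd] /andP[z0 zd] fy.
  rewrite ltNge; apply/negP => fz.
  have [yz|/ltW zy] := leP y z.
    by apply: (@sgf y z) => //; rewrite ge_min fz orbT le_max ltW.
  by apply: (@sgf z y) => //; rewrite ge_min fz le_max (ltW fy) orbT.
have zero : 0 \in `[0, d] by apply: in0d; lra.
have [f0|f0] := ltP 0 (f 0).
  have -> : x = 0.
    apply: xlt => y yd; rewrite ltr_pdivrMr ?A0// -subr_gt0.
    exact: same zero yd f0.
  by split; [move=> _; rewrite -subr_ge0 ltW|rewrite ltxx].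
have -> : x = d.
  apply: xgt => y yd; rewrite ltr_pdivlMr ?A0// -subr_lt0.
  rewrite lt_neqAle fneq0//= leNgt.
  by apply/negP => /(same _ _ yd zero); lra.
have dd : d \in `[0, d] by apply: in0d; lra.
split; first by rewrite ltxx.
by move=> _; rewrite -subr_le0 leNgt; apply/negP => /(same _ _ dd zero); lra.
Qed.

(* Where [B x <= c x * A x] (resp. [>=]), the cost [x A x + (d - x) B x] is at
   most (resp. at least) [A x * (x + (d - x) c x)], and the other way round for
   [B x * (d - x + x / c x)].  The first expression is increasing in [x] since
   [c <= 1], the second one decreasing. *)
Lemma equalized_cost_le (R : realType) (d : R) (A1 A2 B1 B2 c : R -> R)
    (x1 x2 : R) :
  x1 \in `[0, d] -> x2 \in `[0, d] ->
  derivable_on `[0, d] c ->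
  {in `[0, d] &, {homo c : y z / y <= z}} ->
  (forall y, y \in `[0, d] -> 0 <= c y) -> c d <= 1 ->
  (forall y, y \in `[0, d] ->
     c y * (1 - c y) - y * derive_on `[0, d] c y <= 0) ->
  {in `[0, d] &, {homo A1 : y z / y <= z}} ->
  {in `[0, d] &, {homo B1 : y z /~ y <= z}} ->
  (forall y, y \in `[0, d] -> 0 < A1 y <= A2 y) ->
  (forall y, y \in `[0, d] -> 0 < B1 y <= B2 y) ->
  (x1 < d -> B1 x1 <= c x1 * A1 x1) -> (0 < x1 -> c x1 * A1 x1 <= B1 x1) ->
  (x2 < d -> B2 x2 <= c x2 * A2 x2) -> (0 < x2 -> c x2 * A2 x2 <= B2 x2) ->
  x1 * A1 x1 + (d - x1) * B1 x1 <= x2 * A2 x2 + (d - x2) * B2 x2.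
Proof.
move=> x1d x2d dc c_homo c_ge0 cd_le1 c_ineq A1_homo B1_homo A12 B12.
move=> le1 ge1 le2 ge2.
have [x10 x1d'] : 0 <= x1 /\ x1 <= d by move: x1d; rewrite in_itv => /andP.
have [x20 x2d'] : 0 <= x2 /\ x2 <= d by move: x2d; rewrite in_itv => /andP.
have /andP[A1x1 A12x1] := A12 _ x1d; have /andP[A1x2 A12x2] := A12 _ x2d.
have /andP[B1x1 B12x1] := B12 _ x1d; have /andP[B1x2 B12x2] := B12 _ x2d.
have [x12|x21|x12] := ltgtP x1 x2; last first.
- by rewrite x12 lerD// ler_wpM2l//; lra.
(* Since [x2 < x1 <= d], [le2] bounds the positive [B2 x2] by [c x2 * A2 x2], so [c x2] cannot be
   zero. *)
- have cx2 : 0 < c x2.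
    have c2 := c_ge0 _ x2d; have := le2 ltac:(lra); nra.
  have cx12 := c_homo _ _ x2d x1d (ltW x21).
  have cx1 : 0 < c x1 by lra.
  have hle := div_subr_nonincreasing dc c_homo c_ineq x20 (ltW x21) x1d' cx2.
  have h0 : 0 <= x1 / c x1 by rewrite divr_ge0// ltW.
  have B1le := B1_homo _ _ x1d x2d (ltW x21).
  (* [x2 < x1] gives [0 < x1] and [x2 < d], so exactly [ge1] and [le2] are available: the [A] terms
     are traded for [B] terms. *)
  have step1 : x1 * A1 x1 <= x1 / c x1 * B1 x1.
    by rewrite mulrAC ler_pdivlMr// -mulrA ler_wpM2l// mulrC; apply: ge1; lra.
  have step2 : x2 / c x2 * B2 x2 <= x2 * A2 x2.
    rewrite mulrAC ler_pdivrMr// -mulrA ler_wpM2l// [_ * c _]mulrC.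
    by apply: le2; lra.
  have step3 : (d - x1 + x1 / c x1) * B1 x1 <= (d - x2 + x2 / c x2) * B2 x2.
    by apply: ler_pM; lra.
  lra.
- have cx12 := c_homo _ _ x1d x2d (ltW x12).
  have cx1 := c_ge0 _ x1d; have cx2 := c_ge0 _ x2d.
  have cx2d : c x2 <= c d.
    by apply: c_homo; rewrite ?in_itv/= ?lexx ?andbT//; lra.
  have A1le := A1_homo _ _ x1d x2d (ltW x12).
  (* Now [x1 < d] and [0 < x2], so [le1] and [ge2] trade the [B] terms for [A] terms. *)
  have step1 : (d - x1) * B1 x1 <= (d - x1) * (c x1 * A1 x1).
    by rewrite ler_wpM2l//; [lra|apply: le1; lra].
  have step2 : (d - x2) * (c x2 * A2 x2) <= (d - x2) * B2 x2.
    by rewrite ler_wpM2l//; [lra|apply: ge2; lra].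
  (* The difference of the two sides is [(x2 - x1) * (1 - c x1) + (d - x2) * (c x2 - c x1)], and
     [c x1 <= c d <= 1]. *)
  have g_le : x1 + (d - x1) * c x1 <= x2 + (d - x2) * c x2 by nra.
  have step3 : (x1 + (d - x1) * c x1) * A1 x1
      <= (x2 + (d - x2) * c x2) * A2 x2.
    by apply: ler_pM; nra.
  lra.
Qed.

(** * Positivity, monotonicity and regularity of path costs *)

Section PathCost.
Context {R : realType} {E : finType}.
Variable tau : E -> R -> R.
Hypothesis tau_cost : forall e, cost_function (tau e).
Implicit Types (A : {set E}) (y z : R).

Lemma path_cost_ge0 A y : 0 <= y -> 0 <= path_cost tau A y.
Proof.
move=> y0; apply: sumr_ge0 => e _.
by have [_ tau0 _ _] := tau_cost e; exact/ltW/tau0.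
Qed.

Lemma path_cost_gt0 A y : A != finset.set0 -> 0 <= y -> 0 < path_cost tau A y.
Proof.
move=> /finset.set0Pn [e eA] y0; rewrite /path_cost (big_setD1 e)//=.
have [_ tau0 _ _] := tau_cost e.
by apply: ltr_wpDr; [exact: path_cost_ge0|exact: tau0].
Qed.

Lemma path_cost_homo A y z :
  0 <= y -> y <= z -> path_cost tau A y <= path_cost tau A z.
Proof.
move=> y0 yz; apply: ler_sum => e _; have [_ _ tau_homo _] := tau_cost e.
by apply: tau_homo; rewrite ?in_itv/= ?andbT//; lra.
Qed.

Lemma path_cost_setID A B y :
  path_cost tau A y = path_cost tau (A :&: B) y + path_cost tau (A :\: B) y.
Proof. by rewrite /path_cost (big_setID B). Qed.

Lemma path_cost_derivable A : derivable_on `[0, +oo[ (path_cost tau A).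
Proof. by apply: derivable_on_sum => e; have [] := tau_cost e. Qed.

Lemma path_cost_continuous (d : R) A :
  {within `[0, d], continuous (path_cost tau A)}.
Proof.
have sub : `[0, d] `<=` `[0, +oo[ by apply: subset_itv; rewrite bnd_simp.
apply: (continuous_subspaceW sub).
exact/derivable_on_continuous/path_cost_derivable.
Qed.

(** By the mean value theorem on [[y, d]], the difference of the two costs has a nonnegative
    increment because its derivative is nonnegative. *)
Lemma path_cost_increment_le (d y : R) A B :
  (forall z, z \in `[0, d] -> derive_on `[0, +oo[ (path_cost tau A) z
    <= derive_on `[0, +oo[ (path_cost tau B) z) ->
  y \in `[0, d] ->
  path_cost tau A d - path_cost tau A y
    <= path_cost tau B d - path_cost tau B y.
Proof.
move=> dAB; rewrite in_itv /= => /andP[y0 yd].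
pose f z := path_cost tau B z - path_cost tau A z.
pose df z := derive_on `[0, +oo[ (path_cost tau B) z
  - derive_on `[0, +oo[ (path_cost tau A) z.
have [|||z zyd fE] := @MVT_segment R f df y d => //.
- move=> z; rewrite in_itv /= => /andP[yz zd].
  (* Only points of the open interval are needed, so [z] avoids [0], where the derivative is
     one-sided. *)
  have z0 : (`[0, +oo[%classic : set R)° z
    by rewrite interior_itv /= in_itv /= andbT; lra.
  apply: is_deriveB; apply: derivable_on_is_derive z0;
    exact: path_cost_derivable.
- have sub : `[y, d] `<=` `[0, d] by apply: subset_itv; rewrite bnd_simp.
  apply: (continuous_subspaceW sub) => z.
  by apply: cvgB; exact: path_cost_continuous.
have : 0 <= f d - f y.
  move: zyd; rewrite fE in_itv /= => /andP[yz zd].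
  by rewrite mulr_ge0 ?subr_ge0// dAB// in_itv /=; lra.
rewrite /f; lra.
Qed.

End PathCost.

(** * Empty simple paths *)

Lemma walk_last (V E : finType) (src tgt : E -> V) (u v : V) (p : seq E) :
  walk src tgt u p v -> v = last u [seq tgt e | e <- p].
Proof.
by elim: p u => [|e p IHp] u /=; [move/eqP|case/andP => _ /IHp].
Qed.

(** A walk without edges stays at its start; a nonempty walk from [s] back to [s] would repeat [s]
    in its duplicate-free vertex list. *)
Lemma simple_path_eq0 (V E : finType) (src tgt : E -> V) (s t : V)
    (P : {set E}) :
  simple_path src tgt s t P -> (P == finset.set0) = (s == t).
Proof.
case=> -[|e p] [w u ->].
  by rewrite [s == t]w; apply/eqP/setP => e; rewrite !inE.
apply/eqP/eqP => [/setP/(_ e)|st]; first by rewrite !inE eqxx.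
by move: u; rewrite /= st (walk_last w) /= mem_last.
Qed.

Theorem theorem15 (R : realType) (V E : finType) (src tgt : E -> V) (s t : V)
    (d : R) (tau : E -> R -> R) (Q : {set E}) (c : R -> R)
    (x : {set E} -> R)
    (d_rational : rational d) (d_gt0 : 0 < d)
    (tau_cost : forall e, cost_function (tau e))
    (Q_path : simple_path src tgt s t Q)
    (c_derivable : derivable_on `[0, d] c)
    (c_nondecreasing : {in `[0, d] &, {homo c : y z / y <= z}})
    (c_ge0 : forall y, y \in `[0, d] -> 0 <= c y)
    (cd_gt0 : 0 < c d)
    (x_quotient : quotient_model d tau Q c (simple_path src tgt s t) x)
    (cd_le1 : c d <= 1)
    (c_ineq : forall y, y \in `[0, d] ->
       c y * (1 - c y) - y * derive_on `[0, d] c y <= 0) :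
  pareto_conform d tau Q (simple_path src tgt s t) x.
Proof.
move=> P1 P2 P1_path P2_path dom.
(* If [s = t], both alternatives are the empty path and the costs agree. Otherwise all paths are
   nonempty, which makes the denominators of the model positive. *)
have [st|st] := eqVneq s t.
  have P0 P : simple_path src tgt s t P -> P = finset.set0.
    by move=> /simple_path_eq0; rewrite st eqxx => /eqP.
  by rewrite (P0 _ P1_path) (P0 _ P2_path).
have P_neq0 P : simple_path src tgt s t P -> P != finset.set0.
  by move=> /simple_path_eq0 ->.
pose A P y := path_cost tau (P :\: Q) y + path_cost tau (P :&: Q) d.
pose B P y := path_cost tau (Q :\: P) (d - y) + path_cost tau (P :&: Q) d.
have overallE P y : overall_cost d tau Q P y = y * A P y + (d - y) * B P y.
  by rewrite /overall_cost /A /B; ring.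
have AE P y : A P y = path_cost tau P y
    + (path_cost tau (P :&: Q) d - path_cost tau (P :&: Q) y).
  by rewrite /A (path_cost_setID tau P Q y); ring.
have BE P y : B P y = path_cost tau Q (d - y)
    + (path_cost tau (P :&: Q) d - path_cost tau (P :&: Q) (d - y)).
  by rewrite /B (path_cost_setID tau Q P (d - y)) finset.setIC; ring.
have reflect y : y \in `[0, d] -> d - y \in `[0, d] by rewrite !in_itv /=; lra.
have A_gt0 P y : simple_path src tgt s t P -> y \in `[0, d] -> 0 < A P y.
  rewrite in_itv AE /= => /P_neq0 P0 /andP[y0 yd].
  apply: ltr_wpDr; first by rewrite subr_ge0 path_cost_homo.
  exact: path_cost_gt0.
(* [B P y] is at least the cost of [Q] at [d - y], which is positive because [Q] is nonempty. *)
have B_gt0 P y : y \in `[0, d] -> 0 < B P y.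
  move=> /reflect; rewrite in_itv BE /= => /andP[y0 yd].
  apply: ltr_wpDr; first by rewrite subr_ge0 path_cost_homo.
  exact/path_cost_gt0/y0/P_neq0.
have equalized P : simple_path src tgt s t P ->
    (x P < d -> B P (x P) <= c (x P) * A P (x P)) /\
    (0 < x P -> c (x P) * A P (x P) <= B P (x P)).
  move=> P_path; have [xd xsol xlt xgt] := x_quotient P P_path.
  apply: quotient_equalization => //.
  - by move=> y; apply: cvgD; [exact: path_cost_continuous|exact: cvg_cst].
  - move=> y; apply: cvgD; last exact: cvg_cst.
    exact/within_continuous_reflect/path_cost_continuous.
  - exact: derivable_on_continuous.
  - by move=> y; exact: A_gt0.
have [le1 ge1] := equalized _ P1_path; have [le2 ge2] := equalized _ P2_path.
(* The derivative half of dominance enters here; it is used at [y] to compare the [A] terms and at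
   [d - y] to compare the [B] terms. *)
have increment_le y : y \in `[0, d] ->
    path_cost tau (P1 :&: Q) d - path_cost tau (P1 :&: Q) y
      <= path_cost tau (P2 :&: Q) d - path_cost tau (P2 :&: Q) y.
  by apply: path_cost_increment_le => // z /dom[].
have [x1d _ _ _] := x_quotient _ P1_path.
have [x2d _ _ _] := x_quotient _ P2_path.
rewrite !overallE; apply: equalized_cost_le le1 ge1 le2 ge2 => //.
- move=> y z; rewrite !in_itv /= => /andP[y0 _] _ yz.
  by rewrite lerD2r path_cost_homo.
- move=> y z; rewrite !in_itv /= => /andP[y0 yd] /andP[z0 zd] yz.
  by rewrite lerD2r path_cost_homo//; lra.
- move=> y yd; rewrite A_gt0//= !AE lerD ?increment_le//.
  by have [] := dom _ yd.
- by move=> y yd; rewrite B_gt0//= !BE lerD2l increment_le// reflect.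
Qed.
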